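(* Let $p\ge 3$ be an integer. Then the minimum value of the $ABS$ index in the class $\Gamma_{p+2,p}$ is attained uniquely (up to isomorphism) by the balanced double star.
   Context: All graphs are finite and simple. For a graph $G$, $d_u$ denotes the degree of the vertex $u$ in $G$, and the atom-bond sum-connectivity (ABS) index is $$ABS(G)=\sum_{uv\in E(G)}\sqrt{1-\frac{2}{d_u+d_v}}.$$ A pendent vertex of a tree is a vertex of degree one. For positive integers $n,p$, $\Gamma_{n,p}$ denotes the class of all trees with exactly $n$ vertices and exactly $p$ pendent vertices. A double star is a tree with exactly two non-pendent vertices; a double star with non-pendent vertices $u$ and $v$ is called balanced if $|d_u-d_v|\le 1$. *)

(* Defs.v *)
From HB Require Import structures.
From mathcomp Require Import all_boot all_order all_algebra.
From mathcomp Require Import reals.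

Set Implicit Arguments.
Unset Strict Implicit.
Unset Printing Implicit Defensive.

Import Order.TTheory GRing.Theory Num.Theory.

Record sgraph := SGraph {
  vertex :> finType;
  adj : rel vertex;
  adj_sym : symmetric adj;
  adj_irrefl : irreflexive adj }.

Arguments adj {s} : rename.

(* Edges are unordered: each one is the two-element set of its endpoints. *)
Definition edges (G : sgraph) : {set {set G}} :=
  [set [set uv.1; uv.2] | uv : G * G & adj uv.1 uv.2].

Definition deg (G : sgraph) (u : G) : nat := #|[set v | adj u v]|.

Definition pendent (G : sgraph) (u : G) : bool := deg u == 1.

(* For [e = [set u; v]] with [u != v], the inner sum is [d_u + d_v]; it is at
   least 2 on every edge, so the division and the root are never degenerate. *)
Definition ABS (R : realType) (G : sgraph) : R :=
  (\sum_(e in edges G)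
     Num.sqrt (1 - 2 / (\sum_(u in e) deg u)%N%:R))%R.

Definition connected (G : sgraph) : Prop := forall u v : G, connect adj u v.

(* [ucycle] alone would also accept an edge traversed back and forth, hence the
   bound on the length. *)
Definition acyclic (G : sgraph) : Prop :=
  forall c : seq G, 2 < size c -> ~ ucycle adj c.

Definition tree (G : sgraph) : Prop :=
  [/\ 0 < #|G|, connected G & acyclic G].

Definition Gamma (n p : nat) (G : sgraph) : Prop :=
  [/\ tree G, #|G| = n & #|[set u : G | pendent u]| = p].

Definition double_star (G : sgraph) : Prop :=
  tree G /\ #|[set u : G | ~~ pendent u]| = 2.

Definition balanced_double_star (G : sgraph) : Prop :=
  double_star G /\
  forall u v : G, ~~ pendent u -> ~~ pendent v ->
    (`|(deg u)%:Z - (deg v)%:Z| <= 1)%R.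

Definition isomorphic (G H : sgraph) : Prop :=
  exists2 f : G -> H, bijective f & forall u v, adj (f u) (f v) = adj u v.

(* Main.v *)
Require Import Defs.
From HB Require Import structures.
From mathcomp Require Import all_boot all_order all_algebra.
From mathcomp Require Import reals.
From mathcomp Require Import zify ring lra.
Set Implicit Arguments.
Unset Strict Implicit.
Unset Printing Implicit Defensive.
Import Order.TTheory GRing.Theory Num.Theory.

(** A tree with [p + 2] vertices of which [p] are pendent has exactly two
    non-pendent vertices, so it is a double star: the two centres are adjacent
    and every other vertex is a leaf hanging on one of them.  If the centres
    carry [a] and [b] leaves, then [a, b > 0], [a + b = p] and

      ABS = star_weight a + star_weight b + edge_weight (p + 2),

    where [star_weight k = k * sqrt (1 - 2 / (k + 2))] collects the [k] edges
    at a centre of degree [k + 1] that lead to leaves.  The last term depends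
    on [p] only, and [star_weight] is strictly convex on the positive integers,
    so for a fixed sum [a + b] the index is smallest exactly when [a] and [b]
    differ by at most one ([star_weight_balanced]).  The pair [{a, b}]
    determines the tree up to isomorphism ([has_roles_iso]), whence uniqueness.

    Double stars are handled through role maps: each vertex is sent to one of
    the four roles (which side, centre or leaf), adjacency is a function of the
    two roles, and the sizes of the four fibres are [1, 1, a, b]
    ([has_roles]).  Degrees, cardinals and the index are then sums over four
    roles, and two graphs with the same fibre sizes are isomorphic through any
    bijection that preserves roles ([fibre_bijection]).

    Strict convexity of [g x = x * sqrt (1 - 2 / (x + 2))] comes from the
    tangent at the middle point [y = x + 1]: there [g' y = g y * t] with
    [t = (y + 3) / (y (y + 2))], and both [g (y + 1) > g y * (1 + t)] and
    [g (y - 1) > g y * (1 - t)] are rational inequalities after squaring. *)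

(** * Role maps of double stars *)

(** First component: the side of the double star; second component: whether the
    vertex is the centre of that side. *)
Definition role : predArgType := (bool * bool)%type.

Definition role_adj (r s : role) : bool :=
  if r.2 && s.2 then r.1 != s.1 else (r.2 != s.2) && (r.1 == s.1).

Definition role_count (a b : nat) (r : role) : nat :=
  if r.2 then 1 else if r.1 then b else a.

Definition has_roles (G : sgraph) (a b : nat) (c : G -> role) : Prop :=
  (forall x y, adj x y = role_adj (c x) (c y)) /\
  (forall r, #|[set x | c x == r]| = role_count a b r).

Definition role_deg (a b : nat) (r : role) : nat :=
  if r.2 then (if r.1 then b else a).+1 else 1.

Lemma big_role (V : nmodType) (F : role -> V) (P : pred role) :
  (\sum_(r | P r) F r = (if P (true, true) then F (true, true) else 0) +
   (if P (true, false) then F (true, false) else 0) +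
   ((if P (false, true) then F (false, true) else 0) +
   (if P (false, false) then F (false, false) else 0)))%R.
Proof.
pose g s k := if P (s, k) then F (s, k) else 0%R.
rewrite big_mkcond /= (eq_bigr (fun r => g r.1 r.2)) => [|[] //].
by rewrite -(pair_bigA _ g) /= !big_bool.
Qed.

Lemma sum_by_role (V : nmodType) (T : finType) (c : T -> role)
    (P : pred role) (F : role -> V) :
  (\sum_(x | P (c x)) F (c x) =
   \sum_(r | P r) F r *+ #|[set x | c x == r]|)%R.
Proof.
rewrite (partition_big c P) //=; apply: eq_bigr => r Pr.
rewrite (eq_bigr (fun=> F r)); last by move=> x /andP[_ /eqP->].
rewrite sumr_const; congr (_ *+ _)%R; apply: eq_card => x.
by rewrite inE unfold_in; case: eqP => [->|]; rewrite ?andbF ?Pr.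
Qed.

(** Inside each fibre, the [i]-th element is sent to the [i]-th element; maps
    built in this way in both directions are inverse to each other. *)
Lemma fibre_bijection (T U C : finType) (c : T -> C) (d : U -> C) :
  (forall k, #|[set x | c x == k]| = #|[set y | d y == k]|) ->
  exists2 f : T -> U, bijective f & forall x, d (f x) = c x.
Proof.
pose e (W : finType) (h : W -> C) k := enum [set x | h x == k].
have half (A B : finType) (g : A -> C) (h : B -> C) :
    (forall k, #|[set x | g x == k]| = #|[set y | h y == k]|) ->
  exists f : A -> B, (forall x, h (f x) = g x) /\
     (forall x, index (f x) (e _ h (g x)) = index x (e _ g (g x))).
  move=> E.
  have lt x : index x (e _ g (g x)) < size (e _ h (g x)).
    by rewrite /e -cardE -E cardE index_mem mem_enum inE.
  (* The default value of [nth] below must come from the fibre: [B] has no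
     distinguished element, so it depends on [x]. *)
  have wit x : {y : B | y \in e _ h (g x)}.
    case def: (e _ h (g x)) (lt x) => [|y s] // _.
    by exists y; rewrite mem_head.
  exists (fun x => nth (sval (wit x)) (e _ h (g x)) (index x (e _ g (g x)))).
  split=> x; last by rewrite index_uniq ?enum_uniq.
  move: (nth _ _ _) (mem_nth (sval (wit x)) (lt x)) => y.
  by rewrite /e mem_enum inE => /eqP.
move=> cd_card; have [f [fc fi]] := half _ _ _ _ cd_card.
have [g [gc gi]] := half _ _ _ _ (fun k => esym (cd_card k)).
have inj (W : finType) (h : W -> C) x y : h x = h y ->
    index x (e _ h (h x)) = index y (e _ h (h x)) -> x = y.
  by move=> hxy /index_inj->; rewrite ?/e ?mem_enum ?inE ?hxy.
exists f => //; exists g => [x|y].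
  by apply: (inj _ c); rewrite gc fc // -[in LHS](fc x) gi fc fi.
by apply: (inj _ d); rewrite fc gc // -[in LHS](gc y) fi gc gi.
Qed.

Section Roles.
Variables (G : sgraph) (a b : nat) (c : G -> role).
Hypothesis cP : has_roles a b c.

Lemma has_roles_deg x : deg x = role_deg a b (c x).
Proof.
case: cP => cadj ccard.
rewrite /deg cardsE -sum1_card.
rewrite (eq_bigl (fun y => role_adj (c x) (c y))) => [|y]; last by rewrite -cadj.
rewrite (sum_by_role c (role_adj (c x)) (fun=> 1)) big_role !ccard.
case: (c x) => [[] []] /=; rewrite /role_adj /role_count /role_deg /=; lia.
Qed.

Lemma has_roles_centre s :
  exists2 w : G, c w = (s, true) & forall x, c x = (s, true) -> x = w.
Proof.
case: cP => _ /(_ (s, true)) /eqP /cards1P[w /setP Ew].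
exists w => [|x cx].
  by have := Ew w; rewrite !inE eqxx => /eqP.
by have := Ew x; rewrite !inE cx eqxx => /esym/eqP.
Qed.

Lemma has_roles_card : #|G| = (a + b).+2.
Proof.
case: cP => _ ccard.
rewrite -sum1_card (sum_by_role c predT (fun=> 1)) big_role !ccard.
by rewrite /role_count /=; lia.
Qed.

(** The two sides are interchangeable, so one may assume [a <= b]. *)
Lemma has_roles_swap : has_roles b a (fun x => (~~ (c x).1, (c x).2)).
Proof.
case: cP => cadj ccard; split=> [x y|[s k]].
  by rewrite cadj; case: (c x) (c y) => [[] []] [[] []].
rewrite (_ : role_count b a (s, k) = role_count a b (~~ s, k)); last by case: s k => [] [].
rewrite -ccard; apply: eq_card => x; rewrite !inE.
by case: (c x) s k => [[] []] [] [].
Qed.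

Hypotheses (a_gt0 : 0 < a) (b_gt0 : 0 < b).

Lemma has_roles_pendent x : pendent x = ~~ (c x).2.
Proof. by rewrite /pendent has_roles_deg /role_deg; case: (c x) => [[] []] /=; lia. Qed.

Lemma has_roles_card_leaf : #|[set x : G | pendent x]| = a + b.
Proof.
rewrite cardsE -sum1_card (eq_bigl (fun x => ~~ (c x).2)) => [|x]; last first.
  by rewrite -has_roles_pendent.
rewrite (sum_by_role c (fun r => ~~ r.2) (fun=> 1)) big_role.
by case: cP => _ ccard; rewrite !ccard /role_count /=; lia.
Qed.

Lemma has_roles_card_centre : #|[set x : G | ~~ pendent x]| = 2.
Proof.
have := cardsC [set x : G | pendent x]; rewrite has_roles_card_leaf has_roles_card.
rewrite (_ : ~: _ = [set x | ~~ pendent x]); last by apply/setP=> x; rewrite !inE.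
lia.
Qed.

Lemma has_roles_connected : connected G.
Proof.
case: cP => cadj _.
have [u cu _] := has_roles_centre false; have [v cv _] := has_roles_centre true.
have symc : connect_sym (@adj G) by apply: sym_connect_sym; apply: adj_sym.
suff H x : connect adj u x by move=> x y; apply: connect_trans (H y); rewrite symc.
have uv : connect adj u v by apply: connect1; rewrite cadj cu cv.
case cx: (c x) => [[] []].
- have [w _ wU] := has_roles_centre true; rewrite (wU x cx) -(wU v cv) //.
- by apply: (connect_trans uv); apply: connect1; rewrite cadj cx cv.
- have [w _ wU] := has_roles_centre false; rewrite (wU x cx) -(wU u cu) //.
- by apply: connect1; rewrite cadj cx cu.
Qed.

End Roles.

(** The successor and the predecessor of a vertex on a cycle of length at least
    three are two distinct neighbours. *)
Lemma ucycle_deg_gt1 (G : sgraph) (c : seq G) x :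
  2 < size c -> ucycle adj c -> x \in c -> 1 < deg x.
Proof.
move=> szc /andP[cc uc] /rot_to[i s def].
have: 2 < size (x :: s) by rewrite -def size_rot.
have: cycle adj (x :: s) by rewrite -def rot_cycle.
have: uniq (x :: s) by rewrite -def rot_uniq.
case: s {def} => [|y [|z s]] //.
rewrite /= => /and4P[_ yN _ _] /and3P[xy _]; rewrite rcons_path => /andP[_ zx] _.
rewrite /deg (cardD1 y) (cardD1 (last z s)) !inE xy adj_sym zx.
by rewrite (_ : last z s != y) //; apply: contraNneq yN => <-; apply: mem_last.
Qed.

(** A cycle avoids pendent vertices, so it would need three non-pendent ones. *)
Lemma acyclic_few_centres (G : sgraph) :
  #|[set x : G | ~~ pendent x]| <= 2 -> acyclic G.
Proof.
move=> le2 c szc uc; have /andP[_ /card_uniqP szE] := uc.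
have: #|c| <= #|[set x : G | ~~ pendent x]|.
  apply/subset_leq_card/subsetP => x /(ucycle_deg_gt1 szc uc).
  by rewrite inE /pendent; case: ltngtP.
rewrite szE; lia.
Qed.

Lemma has_roles_tree (G : sgraph) a b (c : G -> role) :
  has_roles a b c -> 0 < a -> 0 < b -> tree G.
Proof.
move=> cP a0 b0; split.
- by rewrite (has_roles_card cP).
- exact: has_roles_connected cP.
- by apply: acyclic_few_centres; rewrite (has_roles_card_centre cP).
Qed.

Lemma has_roles_iso (G H : sgraph) a b (c : G -> role) (d : H -> role) :
  has_roles a b c -> has_roles a b d -> isomorphic G H.
Proof.
move=> [cadj ccard] [dadj dcard].
have [k|f fbij fc] := @fibre_bijection _ _ _ c d; first by rewrite ccard dcard.
by exists f => // x y; rewrite dadj !fc cadj.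
Qed.

Lemma iso_has_roles (G H : sgraph) a b (d : H -> role) (f : G -> H) :
  bijective f -> (forall x y, adj (f x) (f y) = adj x y) ->
  has_roles a b d -> has_roles a b (d \o f).
Proof.
move=> fbij fadj [dadj dcard]; split=> [x y|r]; first by rewrite -fadj dadj.
rewrite -dcard -(on_card_preimset (f := f)); last by case: fbij => g fg gf; exists g => x _; auto.
by apply: eq_card => x; rewrite !inE.
Qed.

(** [None] is the centre of its side. *)
Definition ds_vertex (a b : nat) : finType := (option 'I_a + option 'I_b)%type.

Definition ds_role a b (x : ds_vertex a b) : role :=
  match x with inl o => (false, o == None) | inr o => (true, o == None) end.

Definition ds_adj a b : rel (ds_vertex a b) :=
  fun x y => role_adj (ds_role x) (ds_role y).

Lemma ds_adj_sym a b : symmetric (@ds_adj a b).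
Proof.
by move=> x y; rewrite /ds_adj; case: (ds_role x) (ds_role y) => [[] []] [[] []].
Qed.

Lemma ds_adj_irrefl a b : irreflexive (@ds_adj a b).
Proof. by move=> x; rewrite /ds_adj; case: (ds_role x) => [[] []]. Qed.

Definition dstar a b := SGraph (@ds_adj_sym a b) (@ds_adj_irrefl a b).

(** Every pair of leaf counts is realised; this provides the balanced double
    star. *)
Lemma dstar_roles a b : has_roles a b (@ds_role a b : dstar a b -> role).
Proof.
split=> // r.
rewrite cardsE -sum1_card big_sumType /=.
rewrite !sum1_card.
have K n (s t k : bool) :
   #|[pred o : option 'I_n | (t, o == None) == (s, k)]| =
   if t == s then (if k then 1 else n) else 0.
  case: eqP => [->|ts]; last first.
    by apply: eq_card0 => o; rewrite !inE; apply/eqP => -[].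
  case: k.
    rewrite -(card1 (None : option 'I_n)); apply: eq_card => o.
    by rewrite !inE xpair_eqE eqxx eqb_id.
  transitivity #|predC1 (None : option 'I_n)|; last by rewrite cardC1 card_option card_ord.
  by apply: eq_card => o; rewrite !inE xpair_eqE eqxx eqbF_neg.
case: r => s k; transitivity ((if false == s then (if k then 1 else a) else 0) +
  (if true == s then (if k then 1 else b) else 0)).
  by rewrite -!K; congr (_ + _); apply: eq_card.
by case: s k => [] []; rewrite /role_count /= ?addn0.
Qed.

(** * The index of a double star *)

Definition edge_weight (R : realType) (s : nat) : R :=
  Num.sqrt (1 - 2 / s%:R)%R.

Definition star_weight (R : realType) (k : nat) : R :=
  (edge_weight R k.+2 *+ k)%R.

(** Root the tree at one centre [v].  Sending each other vertex [x] to the edge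
    joining it to its parent is a bijection onto the edges, and the weight of
    that edge depends on the role of [x] only. *)
Lemma has_roles_ABS (R : realType) (G : sgraph) a b (c : G -> role) :
  has_roles a b c ->
  ABS R G = (star_weight R a + star_weight R b + edge_weight R (a + b).+2)%R.
Proof.
move=> cP; have [cadj ccard] := cP.
have [u cu uU] := has_roles_centre cP false.
have [v cv vU] := has_roles_centre cP true.
(* The role of the parent: the centre of the same side for a leaf, the opposite
   centre for a centre. *)
pose up (r : role) : role := (r.2 (+) r.1, true).
pose m x := if (up (c x)).1 then v else u.
have cm x : c (m x) = up (c x).
  by rewrite /m /up /=; case: (_ (+) _).
have mU x y : c y = up (c x) -> y = m x.
  by rewrite /m /up; case: (_ (+) _) => [/vU|/uU].
pose A := [set x | c x != (true, true)].
have edgesE : edges G = [set [set x; m x] | x in A].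
  apply/setP=> e; apply/imsetP/imsetP=> [[[x y] /=]|[x]].
    rewrite inE /= cadj => xy ->.
    have : (c x != (true, true)) && (c y == up (c x))
        || (c y != (true, true)) && (c x == up (c y)).
      by case: (c x) (c y) xy => [[] []] [[] []].
    case/orP=> /andP[Ar /eqP/mU->]; [exists x|exists y]; rewrite ?inE //.
    by rewrite setUC.
  rewrite inE => Ax ->; exists (x, m x) => //; rewrite inE /= cadj cm.
  by case: (c x) Ax => [[] []].
have xm x : x \in A -> x != m x.
  rewrite inE => Ax; apply/eqP => /(congr1 c); rewrite cm.
  by case: (c x) Ax => [[] []].
rewrite /ABS edgesE big_imset /=; last first.
  (* If [x] and [y] gave the same edge, each would be the parent of the other,
     so both would be centres, although the root [v] is excluded. *)
  move=> x y Ax Ay E.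
  have := set21 x (m x); rewrite E => /set2P[//|xy].
  have := set21 y (m y); rewrite -E => /set2P[//|yx].
  move: Ax Ay; rewrite !inE.
  have := cm x; have := cm y; rewrite -xy -yx => -> .
  by case: (c y) => [[] []].
pose F r := edge_weight R (role_deg a b r + role_deg a b (up r)).
rewrite (eq_big (fun x => c x != (true, true)) (fun x => F (c x))); first last.
- move=> x Ax; rewrite big_setU1 ?inE ?xm //= big_set1.
  by rewrite !(has_roles_deg cP) cm.
- by move=> x; rewrite inE.
rewrite (sum_by_role c (fun r => r != (true, true)) F) big_role /= !ccard.
rewrite /F /role_deg /role_count /= /star_weight mulr1n add0r !add1n.
by rewrite addnS addSn; ring.
Qed.

(** * Strict convexity of the star weight *)

Section Weights.
Variable R : realType.
Local Open Scope ring_scope.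

(* The real function that interpolates [star_weight]. *)
Let g (x : R) : R := x * Num.sqrt (1 - 2 / (x + 2)).

Lemma ltr_of_sqr (x y : R) : 0 <= y -> x ^+ 2 < y ^+ 2 -> x < y.
Proof. by move=> y0 xy; case: (ltP x y) => // yx; nra. Qed.

Lemma g_sqr (x : R) : 0 < x -> g x ^+ 2 = x ^+ 3 / (x + 2).
Proof.
move=> x0; have E : 1 - 2 / (x + 2) = x / (x + 2) by field; lra.
rewrite exprMn sqr_sqrtr; last by rewrite E divr_ge0 //; lra.
by rewrite E; field; lra.
Qed.

Lemma g_convex (x : R) : 1 <= x -> g (x + 1) *+ 2 < g x + g (x + 2).
Proof.
move=> x1.
pose y := x + 1.
have y2 : 2 <= y by rewrite /y; lra.
have g0 (z : R) : 0 < z -> 0 <= g z by move=> z0; rewrite mulr_ge0 ?sqrtr_ge0 // ltW.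
(* The logarithmic derivative of [g] at [y]. *)
pose t := (y + 3) / (y * (y + 2)).
(* After squaring, with [s = y ^ 2 + 3 y], the difference is governed by
   [(s + 2) ^ 3 - s (s + 3) ^ 2 = 3 s + 8]. *)
have up : g y * (1 + t) < g (y + 1).
  apply: ltr_of_sqr; first by apply: g0; lra.
  rewrite exprMn !g_sqr; [|lra..]; rewrite -subr_gt0.
  have -> : (y + 1) ^+ 3 / (y + 1 + 2) - y ^+ 3 / (y + 2) * (1 + t) ^+ 2
     = (3 * (y ^+ 2 + 3 * y) + 8) / ((y + 3) * (y + 2) ^+ 3).
    by rewrite /t; field; lra.
  rewrite divr_gt0 ?mulr_gt0 ?exprn_gt0 //; nra.
(* Likewise with [s = y ^ 2 + y] and [(s - 2) ^ 3 - s (s - 3) ^ 2 = 3 s - 8],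
   which is positive since [y >= 2]. *)
have down : g y * (1 - t) < g (y - 1).
  apply: ltr_of_sqr; first by apply: g0; lra.
  rewrite exprMn !g_sqr; [|lra..]; rewrite -subr_gt0.
  have -> : (y - 1) ^+ 3 / (y - 1 + 2) - y ^+ 3 / (y + 2) * (1 - t) ^+ 2
     = (3 * (y ^+ 2 + y) - 8) / ((y + 1) * (y + 2) ^+ 3).
    by rewrite /t; field; lra.
  rewrite divr_gt0 ?mulr_gt0 ?exprn_gt0 //; nra.
have -> : x + 2 = y + 1 by rewrite /y; lra.
have -> : g x = g (y - 1) by congr g; rewrite /y; lra.
rewrite -/y; lra.
Qed.

Lemma star_weight_convex k : (0 < k)%N ->
  star_weight R k.+1 *+ 2 < star_weight R k + star_weight R k.+2.
Proof.
have E n : star_weight R n = g n%:R.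
  by rewrite /star_weight /edge_weight /g -natrD addn2 [RHS]mulr_natl.
move=> k0; rewrite !E.
have := @g_convex k%:R; rewrite natr1 -natrD addn2; apply.
by rewrite ler1n.
Qed.

Lemma star_weight_increment i j : (0 < i < j)%N ->
  star_weight R i.+1 - star_weight R i < star_weight R j.+1 - star_weight R j.
Proof.
case/andP=> i0; elim: j => // j IH.
have step n : (0 < n)%N -> star_weight R n.+1 - star_weight R n
     < star_weight R n.+2 - star_weight R n.+1.
  by move/star_weight_convex; lra.
rewrite ltnS leq_eqVlt => /predU1P[<-|ij]; first exact: step.
by apply: lt_trans (IH ij) (step _ _); lia.
Qed.

(** Moving leaves one at a time from the smaller side to the larger one: the
    larger side gains more than the smaller side loses. *)
Lemma star_weight_spread i j k : (0 < i)%N -> (i + k <= j)%N -> (0 < k)%N ->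
  star_weight R (i + k) + star_weight R j < star_weight R i + star_weight R (j + k).
Proof.
move=> i0; elim: k => // -[|k] IH ikj _.
  have /star_weight_increment : (0 < i < j)%N by lia.
  rewrite addn1 addn1; lra.
have := IH _ isT; have /star_weight_increment : (0 < i + k.+1 < j + k.+1)%N by lia.
rewrite -!addnS => H1 H2; have := H2 ltac:(lia); lra.
Qed.

Lemma star_weight_balanced a b a' b' : (0 < a <= b)%N -> (a' <= b' <= a'.+1)%N ->
  (a + b = a' + b')%N -> (a, b) != (a', b') ->
  star_weight R a' + star_weight R b' < star_weight R a + star_weight R b.
Proof.
move=> /andP[a0 ab] /andP[le1 le2] E; rewrite xpair_eqE => ne.
have lt : (a < a')%N by move: ne; case: (ltngtP a a') => //=; lia.
have := @star_weight_spread a b' (a' - a).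
rewrite subnKC; last exact: ltnW.
rewrite (_ : b' + (a' - a) = b)%N; last by lia.
by apply; lia.
Qed.

End Weights.

(** * Trees with two non-pendent vertices *)

(** The form in which connectedness is used below: a set closed under adjacency
    that contains one vertex contains them all. *)
Lemma connected_closed (G : sgraph) (S : pred G) x :
  connected G -> (forall y z, adj y z -> S y -> S z) -> S x -> forall y, S y.
Proof.
move=> conG clS Sx y; have /connectP[s + ->] := conG x y.
by elim: s x Sx => //= z s IH x Sx /andP[xz]; apply: IH (clS _ _ xz Sx).
Qed.

Lemma pendent_nbr (G : sgraph) (x y z : G) :
  pendent x -> adj x y -> adj x z -> y = z.
Proof.
by rewrite /pendent /deg => /cards1P[w /setP E] xy xz; move: (E y) (E z);
  rewrite !inE xy xz => /esym/eqP-> /esym/eqP.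
Qed.

(** Two adjacent pendent vertices would form a whole component, so each leaf
    hangs on a centre.  If the centres [u] and [v] were not adjacent, [u] and
    its leaves would form a whole component without [v].  Each side has a leaf
    because a centre whose only neighbour is the other centre is pendent. *)
Lemma two_centres_roles (G : sgraph) : connected G ->
  #|[set x : G | ~~ pendent x]| = 2 ->
  exists a b (c : G -> role), [/\ has_roles a b c, 0 < a & 0 < b].
Proof.
move=> conG /eqP /cards2P[u [v [uv /setP cE]]].
have centreE (x : G) : ~~ pendent x = (x == u) || (x == v) by have := cE x; rewrite !inE.
have uNp : ~~ pendent u by rewrite centreE eqxx.
have leaf_leafF (x y : G) : pendent x -> pendent y -> adj x y = false.
  move=> px py; apply/negP => xy.
  have : pendent u; last by apply/negP.
  suff : u \in [set x; y] by case/set2P=> ->.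
  apply: (@connected_closed G [in [set x; y]] x) => //; last by rewrite set21.
  move=> z w zw /set2P[] E; rewrite E in zw.
    by rewrite (pendent_nbr px zw xy) set22.
  by rewrite adj_sym in xy; rewrite (pendent_nbr py zw xy) set21.
have uvadj : adj u v.
  apply: contraT => Nuv.
  have : v \in [pred x | (x == u) || (x != v) && adj x u].
    apply: (@connected_closed G _ u) => //=; last by rewrite eqxx.
    move=> y z yz /predU1P[yu|/andP[yv yu]].
      rewrite yu in yz; rewrite adj_sym yz andbT.
      by rewrite (_ : z != v) ?orbT //; apply: contraNneq Nuv => <-.
    have [-> //|zu] := eqVneq z u.
    have py : pendent y.
      have [yu'|yu'] := eqVneq y u; first by rewrite yu' adj_irrefl in yu.
      by apply: contraT; rewrite centreE (negPf yv) (negPf yu').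
    by rewrite (pendent_nbr py yz yu) eqxx in zu.
  by rewrite inE /= eqxx eq_sym (negPf uv).
have leaf_nbr (x : G) : pendent x -> adj x u = ~~ adj x v.
  move=> px; have [xu|Nxu] := boolP (adj x u).
    by case: (boolP (adj x v)) => // xv; move: uv; rewrite (pendent_nbr px xu xv) eqxx.
  have /cards1P[y /setP/(_ y)] := px; rewrite !inE eqxx => xy.
  have [py|] := boolP (pendent y); first by rewrite leaf_leafF in xy.
  rewrite centreE => /orP[] /eqP E; rewrite E in xy; first by rewrite xy in Nxu.
  by rewrite xy.
pose c x : role := if x == u then (false, true) else
  if x == v then (true, true) else (adj x v, false).
pose n s := #|[set x | c x == (s, false)]|.
have cP : has_roles (n false) (n true) c.
  split=> [x y|[s [|]]]; last by case: s.
    have leafP z : z != u -> z != v -> pendent z.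
      by move=> zu zv; apply: contraT; rewrite centreE (negPf zu) (negPf zv).
    have vuadj : adj v u by rewrite adj_sym.
    have [vu1 uv1] : (v == u) = false /\ (u == v) = false.
      by rewrite eq_sym (negPf uv).
    rewrite /c; case: (eqVneq x u) => [->|xu]; case: (eqVneq y u) => [->|yu].
    - by rewrite adj_irrefl.
    - case: (eqVneq y v) => [->|yv]; first by rewrite uvadj.
      by rewrite /role_adj /= adj_sym leaf_nbr ?leafP //; case: adj.
    - case: (eqVneq x v) => [->|xv]; first by rewrite vuadj.
      by rewrite /role_adj /= leaf_nbr ?leafP //; case: adj.
    case: (eqVneq x v) => [->|xv]; case: (eqVneq y v) => [->|yv].
    - by rewrite adj_irrefl.
    - by rewrite /role_adj /= adj_sym; case: adj.
    - by rewrite /role_adj /=; case: adj.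
    by rewrite leaf_leafF ?leafP.
  rewrite /role_count /= -(cards1 (if s then v else u)); apply: eq_card => x.
  rewrite !inE /c; have [->|xu] := eqVneq x u.
    by case: s; rewrite /= ?(negPf uv) ?eqxx.
  have [->|xv] := eqVneq x v; last by rewrite xpair_eqE andbF; case: s; rewrite ?(negPf xu) ?(negPf xv).
  by case: s; rewrite ?eqxx // [RHS]eq_sym (negPf uv).
have vNp : ~~ pendent v by rewrite centreE eqxx orbT.
exists (n false), (n true), c; split=> //.
  move: uNp; rewrite /pendent (has_roles_deg cP) /c eqxx /role_deg /=; lia.
move: vNp; rewrite /pendent (has_roles_deg cP) /c eqxx [v == u]eq_sym (negPf uv) /role_deg /=; lia.
Qed.

Lemma Gamma_roles p (G : sgraph) : Gamma (p + 2) p G ->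
  exists a b (c : G -> role), [/\ has_roles a b c, 0 < a <= b & a + b = p].
Proof.
case=> -[_ conG _] cardG cardL.
have [|a [b [c [cP a0 b0]]]] := @two_centres_roles G conG.
  have := cardsC [set x : G | pendent x]; rewrite cardL cardG.
  rewrite (_ : ~: _ = [set x | ~~ pendent x]); last by apply/setP=> x; rewrite !inE.
  lia.
have := has_roles_card cP; rewrite cardG => E.
have [ab|ba] := leqP a b.
  by exists a, b, c; split=> //; [rewrite a0|lia].
exists b, a, (fun x => (~~ (c x).1, (c x).2)).
split; [exact: has_roles_swap cP|lia|lia].
Qed.

Lemma has_roles_balanced (G : sgraph) a b (c : G -> role) :
  has_roles a b c -> 0 < a <= b -> balanced_double_star G <-> b <= a.+1.
Proof.
move=> cP /andP[a0 ab]; have b0 : 0 < b by apply: leq_trans ab.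
have pE := has_roles_pendent cP a0 b0; have dE := has_roles_deg cP.
split=> [[_ bal]|ba].
  have [u cu _] := has_roles_centre cP false.
  have [v cv _] := has_roles_centre cP true.
  have := bal u v; rewrite !pE !dE cu cv /role_deg /= => /(_ isT isT); lia.
split.
  split; first exact: has_roles_tree cP a0 b0.
  exact: has_roles_card_centre cP a0 b0.
move=> u v; rewrite !pE !dE /role_deg.
by case: (c u) (c v) => [[] []] [[] []] //= _ _; lia.
Qed.

Theorem theorem4 (R : realType) (p : nat) (hp : 3 <= p) :
  (exists B : sgraph, Gamma (p + 2) p B /\ balanced_double_star B) /\
  (forall B : sgraph, Gamma (p + 2) p B -> balanced_double_star B ->
    forall G : sgraph, Gamma (p + 2) p G ->
      (ABS R B <= ABS R G)%R /\ (ABS R G = ABS R B <-> isomorphic G B)).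
Proof.
split.
  pose a := p./2; pose b := uphalf p.
  have abp : a + b = p by rewrite /a /b; lia.
  have ab : 0 < a <= b by rewrite /a /b; lia.
  have ba : b <= a.+1 by rewrite /a /b; lia.
  have a0 : 0 < a by lia.
  have b0 : 0 < b by lia.
  have cP := dstar_roles a b.
  exists (dstar a b); split; last exact/(has_roles_balanced cP ab).
  split; first exact: has_roles_tree cP a0 b0.
    by rewrite (has_roles_card cP) abp addn2.
  by rewrite (has_roles_card_leaf cP a0 b0).
move=> B /Gamma_roles[a' [b' [d [dP ab' E']]]] /(has_roles_balanced dP ab') ba'.
move=> G /Gamma_roles[a [b [c [cP ab E]]]].
have [[? ?]|ne] := eqVneq (a, b) (a', b').
  subst a' b'; rewrite !(has_roles_ABS R cP, has_roles_ABS R dP).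
  by split=> //; split=> // _; apply: has_roles_iso cP dP.
have lt : (ABS R B < ABS R G)%R.
  rewrite (has_roles_ABS R cP) (has_roles_ABS R dP) E E' ltrD2r.
  by apply: star_weight_balanced => //; lia.
split; first exact: ltW.
split=> [eq|[f fbij fadj]]; first by rewrite eq ltxx in lt.
have fP := iso_has_roles fbij fadj dP.
by rewrite (has_roles_ABS R fP) (has_roles_ABS R dP) ltxx in lt.
Qed.
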